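(* Let $\mathbf{w}=(w_1,w_2,w_3)\in\mathbb{Z}_{>0}^3$ and let $W=\max\{w_1,w_2,w_3\}$. Let $e$ be an integer. If $\Lambda_e(\mathbf{w})$ contains a cubic obstruction configuration, then $1\leq e<4W^2$.
   Context: For $\mathbf{w}\in\mathbb{Z}_{\geq 1}^n$ and an integer $e$, set $\Lambda_e(\mathbf{w})=\{\mathbf{v}\in\mathbb{Z}_{\geq 0}^n \mid \mathbf{w}\cdot\mathbf{v}=e\}$ (here $n=3$). A point $\mathbf{c}\in\Lambda_e(\mathbf{w})$ is midpoint-rigid if, whenever $\mathbf{p},\mathbf{q}\in\Lambda_e(\mathbf{w})$ satisfy $\mathbf{p}+\mathbf{q}=2\mathbf{c}$, one has $\mathbf{p}=\mathbf{q}=\mathbf{c}$. A nontrivial barycenter decomposition of $\mathbf{c}\in\Lambda_e(\mathbf{w})$ is an equality $3\mathbf{c}=\mathbf{u}+\mathbf{v}+\mathbf{z}$ with $\mathbf{u},\mathbf{v},\mathbf{z}\in\Lambda_e(\mathbf{w})$ and $(\mathbf{u},\mathbf{v},\mathbf{z})\neq(\mathbf{c},\mathbf{c},\mathbf{c})$. A cubic obstruction configuration in $\Lambda_e(\mathbf{w})$ is a tuple $(\mathbf{c};\mathbf{u},\mathbf{v},\mathbf{z})$ consisting of a midpoint-rigid point $\mathbf{c}\in\Lambda_e(\mathbf{w})$ and a nontrivial barycenter decomposition $3\mathbf{c}=\mathbf{u}+\mathbf{v}+\mathbf{z}$. *)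

(* Defs.v *)
From mathcomp Require Import all_boot all_order all_algebra.

Set Implicit Arguments.
Unset Strict Implicit.
Unset Printing Implicit Defensive.

Import Order.TTheory GRing.Theory Num.Theory.
Local Open Scope ring_scope.

(* The points of Z_{>= 0}^n are encoded as integer row vectors with
   nonnegative entries, so that e may be an arbitrary integer. *)
Definition Lambda (n : nat) (e : int) (w : 'rV[int]_n) : {pred 'rV[int]_n} :=
  [pred v : 'rV[int]_n |
    [forall i, 0 <= v 0 i] && (\sum_i w 0 i * v 0 i == e)].

Definition midpoint_rigid (n : nat) (e : int) (w c : 'rV[int]_n) : Prop :=
  c \in Lambda e w /\
  forall p q : 'rV[int]_n, p \in Lambda e w -> q \in Lambda e w ->
    p + q = c *+ 2 -> p = c /\ q = c.

Definition nontrivial_barycenter_decomposition (n : nat) (e : int)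
    (w c u v z : 'rV[int]_n) : Prop :=
  [/\ u \in Lambda e w, v \in Lambda e w, z \in Lambda e w,
      c *+ 3 = u + v + z & (u, v, z) <> (c, c, c)].

Definition cubic_obstruction_configuration (n : nat) (e : int)
    (w c u v z : 'rV[int]_n) : Prop :=
  midpoint_rigid e w c /\ nontrivial_barycenter_decomposition e w c u v z.

(* Main.v *)
Require Import Defs.
From mathcomp Require Import all_boot all_order all_algebra.
From mathcomp Require Import zify.

Import Order.TTheory GRing.Theory Num.Theory.
Local Open Scope ring_scope.

(** If [u] lies in [Lambda_e(w)] and [u <> c], rigidity of [c] forbids
    [2c - u >= 0], so [u_i > 2 c_i] for some [i], whence
    [e >= w_i u_i > 2 w_i c_i].  In a nontrivial decomposition [3c = u + v + z]
    all three summands differ from [c], and no two of them can exceed [2c] in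
    the same coordinate; so every coordinate is exceeded and [2 w_i c_i < e] for
    all [i].  Moreover [c_i >= w_j] and [c_j >= w_i] cannot hold together, since
    [c] would be the midpoint of [c +- (w_j e_i - w_i e_j)]; so [c_i < W] for two
    of the three indices.  If [k] is the third one,
    [e < 2 (e - w_k c_k) <= 4 W (W - 1)]. *)

Lemma LambdaP (n : nat) (e : int) (w v : 'rV[int]_n) :
  reflect ((forall i, 0 <= v 0 i) /\ \sum_i w 0 i * v 0 i = e)
          (v \in Lambda e w).
Proof.
rewrite inE; apply: (iffP andP) => [[/forallP v0 /eqP]|[v0 /eqP]] //.
by split=> //; apply/forallP.
Qed.

Lemma le_term_Lambda (n : nat) (e : int) (w v : 'rV[int]_n) (i : 'I_n) :
  (forall j, 0 < w 0 j) -> v \in Lambda e w -> w 0 i * v 0 i <= e.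
Proof.
move=> w0 /LambdaP[v0 <-]; rewrite (bigD1 i) //= lerDl.
by apply: sumr_ge0 => j _; rewrite mulr_ge0 // ltW.
Qed.

Lemma midpoint_rigid_exceeds (n : nat) (e : int) (w c u : 'rV[int]_n) :
  midpoint_rigid e w c -> u \in Lambda e w -> u <> c ->
  exists i, c 0 i *+ 2 < u 0 i.
Proof.
move=> [/LambdaP[c0 cE] rigid] uL uc; apply/existsP; apply: contra_notT uc.
move=> /existsPn le_u; have /LambdaP[_ uE] := uL.
have qL : c *+ 2 - u \in Lambda e w.
  apply/LambdaP; split=> [i|].
    by rewrite [(c *+ 2 - u) _ _]mxE [(- u) _ _]mxE mulmxnE subr_ge0 leNgt.
  under eq_bigr => i _ do
    rewrite [(c *+ 2 - u) _ _]mxE [(- u) _ _]mxE mulmxnE mulrBr mulrnAr.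
  by rewrite sumrB sumrMnl cE uE mulr2n addrK.
by have [] := rigid u _ uL qL (subrKC _ _).
Qed.

Lemma midpoint_rigid_pair (n : nat) (e : int) (w c : 'rV[int]_n) (i j : 'I_n) :
  (forall k, 0 < w 0 k) -> midpoint_rigid e w c -> i != j ->
  c 0 i < w 0 j \/ c 0 j < w 0 i.
Proof.
move=> w0 [/LambdaP[c0 cE] rigid] ij; apply/orP.
apply: contraT; rewrite negb_or -!leNgt => /andP[wj wi].
have ji : (j == i) = false by rewrite eq_sym (negbTE ij).
move: ij => /negbTE ij.
(* The smallest evident integer vector orthogonal to [w] supported on the coordinates [i] and [j];
   adding or subtracting it preserves the weight [e]. *)
pose d : 'rV[int]_n := w 0 j *: delta_mx 0 i - w 0 i *: delta_mx 0 j.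
have dE k : d 0 k = w 0 j * (k == i)%:R - w 0 i * (k == j)%:R.
  by rewrite !mxE eqxx.
clearbody d.
have wd : \sum_k w 0 k * d 0 k = 0.
  rewrite (bigD1 i) //= (bigD1 j) /=; last by rewrite ji.
  rewrite big1 => [|k /andP[ki kj]].
    by rewrite !dE !eqxx ij ji !mulr1 !mulr0 subr0 sub0r addr0 mulrN mulrC subrr.
  by rewrite dE (negbTE ki) (negbTE kj) !mulr0.
(* This one bound makes both [c + d] and [c - d] nonnegative. It uses the negated conclusion at [i]
   and [j], and [0 <= c 0 k] elsewhere. *)
have d_le k : `|d 0 k| <= c 0 k.
  rewrite dE; have := c0 k; have := w0 i; have := w0 j.
  case: (eqVneq k i) => [->|_]; first by rewrite ij mulr1 mulr0; lia.
  by case: (eqVneq k j) => [->|_]; rewrite ?mulr1 mulr0; lia.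
have pL : c + d \in Lambda e w.
  apply/LambdaP; split=> [k|].
    have := d_le k; rewrite [(c + d) _ _]mxE ler_norml => /andP[+ _].
    by rewrite -subr_ge0 opprK addrC.
  under eq_bigr => k _ do rewrite [(c + d) _ _]mxE mulrDr.
  by rewrite big_split /= cE wd addr0.
have qL : c - d \in Lambda e w.
  apply/LambdaP; split=> [k|].
    have := d_le k; rewrite [(c - d) _ _]mxE [(- d) _ _]mxE ler_norml.
    by rewrite subr_ge0 => /andP[].
  under eq_bigr => k _ do rewrite [(c - d) _ _]mxE [(- d) _ _]mxE mulrBr.
  by rewrite sumrB cE wd subr0.
have [|cd _] := rigid _ _ pL qL; first by rewrite addrACA subrr addr0 mulr2n.
(* Rigidity forces [d = 0], but its entry at [i] is [w 0 j > 0]. *)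
have d0 : d = 0 by apply: (addrI c); rewrite addr0.
have := w0 j; move: (dE i); rewrite d0 mxE eqxx ij mulr1 mulr0 subr0 => <-.
by rewrite ltxx.
Qed.

(** If [u = c], cancelling it leaves [v + z = 2c], and rigidity collapses [v] and [z] to [c] as
    well. The other two summands are handled by permuting the decomposition. *)
Lemma barycenter_summand_neq (n : nat) (e : int) (w c u v z : 'rV[int]_n) :
  midpoint_rigid e w c -> v \in Lambda e w -> z \in Lambda e w ->
  c *+ 3 = u + v + z -> (u, v, z) <> (c, c, c) -> u <> c.
Proof.
move=> [_ rigid] vL zL cE nt uc; apply: nt; move: cE; rewrite uc mulrS -addrA.
by move=> /addrI/esym/(rigid _ _ vL zL)[-> ->].
Qed.

Lemma cubic_obstruction_term_lt (e : int) (w c u v z : 'rV[int]_3) (l : 'I_3) :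
  (forall k, 0 < w 0 k) -> cubic_obstruction_configuration e w c u v z ->
  (w 0 l * c 0 l) *+ 2 < e.
Proof.
move=> w0 [rigid [uL vL zL cE nt]].
have [/LambdaP[c0 _] _] := rigid.
have [i ui] : exists i, c 0 i *+ 2 < u 0 i.
  apply: (midpoint_rigid_exceeds _ _ _ _ _ rigid uL).
  exact: barycenter_summand_neq rigid vL zL cE nt.
have [j vj] : exists j, c 0 j *+ 2 < v 0 j.
  apply: (midpoint_rigid_exceeds _ _ _ _ _ rigid vL).
  apply: (barycenter_summand_neq _ _ _ _ _ u z rigid uL zL).
    by rewrite cE [v + u]addrC.
  by move=> [vc uc zc]; apply: nt; rewrite uc vc zc.
have [k zk] : exists k, c 0 k *+ 2 < z 0 k.
  apply: (midpoint_rigid_exceeds _ _ _ _ _ rigid zL).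
  apply: (barycenter_summand_neq _ _ _ _ _ u v rigid uL vL).
    by rewrite cE addrC addrA.
  by move=> [zc uc vc]; apply: nt; rewrite uc vc zc.
have exceeds_lt x t : x \in Lambda e w -> c 0 t *+ 2 < x 0 t ->
    (w 0 t * c 0 t) *+ 2 < e.
  move=> xL xt; apply: lt_le_trans (le_term_Lambda _ _ _ _ t w0 xL).
  by rewrite -mulrnAr ltr_pM2l.
have sumE t : c 0 t *+ 3 = u 0 t + v 0 t + z 0 t.
  by move/rowP: cE => /(_ t); rewrite mulmxnE !mxE.
have [/LambdaP[u0 _] /LambdaP[v0 _] /LambdaP[z0 _]] := And3 uL vL zL.
(* A shared coordinate would give [3 c_i >= u_i + v_i > 4 c_i], against [c_i >= 0]. The next two
   cases are the same. *)
have ij : i != j.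
  apply/eqP => ij; move: vj; rewrite -ij => vi.
  by have := sumE i; have := c0 i; have := z0 i; lia.
have ik : i != k.
  apply/eqP => ik; move: zk; rewrite -ik => zi.
  by have := sumE i; have := c0 i; have := v0 i; lia.
have jk : j != k.
  apply/eqP => jk; move: zk; rewrite -jk => zj.
  by have := sumE j; have := c0 j; have := u0 j; lia.
(* Three distinct indices exhaust ['I_3], so [l] is one of the exceeded coordinates. *)
have : l \in [set i; j; k].
  suff -> : [set i; j; k] = [set: 'I_3] by rewrite inE.
  apply/eqP; rewrite eqEcard subsetT cardsT card_ord.
  by rewrite setUC cardsU1 cards2 !inE ij negb_or ![k == _]eq_sym ik jk.
rewrite !inE -orbA => /or3P[]/eqP->.
- exact: exceeds_lt ui.
- exact: exceeds_lt vj.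
- exact: exceeds_lt zk.
Qed.

Theorem proposition2p3 (w : 'rV[int]_3) (hw : forall i : 'I_3, 0 < w 0 i)
    (e : int)
    (hobs : exists c u v z : 'rV[int]_3,
        cubic_obstruction_configuration e w c u v z) :
  let W : int := Num.max (w 0 0) (Num.max (w 0 1) (w 0 2)) in
  1 <= e /\ e < 4 * W ^+ 2.
Proof.
move=> W; have [c [u [v [z obs]]]] := hobs; have [rigid _] := obs.
have [/LambdaP[c0 cE] _] := rigid.
have lt_e l := cubic_obstruction_term_lt _ _ _ _ _ _ l hw obs.
have [wW0 wW1 wW2] : [/\ w 0 0 <= W, w 0 1 <= W & w 0 2 <= W].
  by rewrite /W !le_max !lexx !orbT.
have wc0 l : 0 <= w 0 l * c 0 l by rewrite mulr_ge0 // ltW.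
split; first by have := lt_e 0; have := wc0 0; lia.
(* Over the integers [c_l < W] means [c_l <= W - 1]. *)
have term_le l : w 0 l <= W -> c 0 l < W -> w 0 l * c 0 l <= W * (W - 1).
  by move=> wl cl; apply: ler_pM => //; [apply: ltW | lia].
have := term_le 0 wW0; have := term_le 1 wW1; have := term_le 2 wW2.
(* By the three pairs, at most one coordinate of [c] can reach [W]. *)
have := midpoint_rigid_pair _ _ _ _ 0 1 hw rigid isT.
have := midpoint_rigid_pair _ _ _ _ 0 2 hw rigid isT.
have := midpoint_rigid_pair _ _ _ _ 1 2 hw rigid isT.
have := lt_e 0; have := lt_e 1; have := lt_e 2.
have W0 : 0 < W by apply: lt_le_trans wW0.
have eE : w 0 0 * c 0 0 + w 0 1 * c 0 1 + w 0 2 * c 0 2 = e.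
  rewrite -cE !big_ord_recl big_ord0 addr0 addrA.
  by congr (_ * _ + _ * _ + _ * _); congr (_ _ _); apply: val_inj.
rewrite expr2 mulrBr mulr1; clearbody W; move: eE wW0 wW1 wW2 W0.
(* With the products abstracted, the rest is linear: if [t] is the term left unbounded, [2t < e]
   gives [e < 2(x + y) <= 4(WW - W) < 4WW]. *)
move: (w 0 0 * c 0 0) (w 0 1 * c 0 1) (w 0 2 * c 0 2) (W * W) => x y t WW.
by lia.
Qed.
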